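(* Let $A$ be a real $m\times n$ matrix with $\mathrm{rank}(A)=n$, and let $\Delta A$ be a real $m\times n$ perturbation of the form $$e_j^T\Delta A=\zeta_j\,\eta_j\,e_j^TA,\qquad 1\le j\le m,\qquad \eta=\max_{1\le j\le m}\eta_j,$$ where $\eta_j\ge0$ and $\zeta_j$ are uniform random variables with values in $[-1,1]$, $1\le j\le m$. Assume $\eta\,\kappa_2(A)<1$. Let $\ell_j$, $1\le j\le m$, be the leverage scores of $A$, and let $\tilde{\ell}_j$, $1\le j\le m$, be the leverage scores of $A+\Delta A$ computed (in exact arithmetic) from a QR decomposition of $A+\Delta A$. Then for every $1\le j\le m$ with $\ell_j>0$ (and for every realization of the $\zeta_j$), $$\frac{|\tilde{\ell}_j-\ell_j|}{\ell_j}\le 2\left(\eta_j+\sqrt{2}\,n\,\eta\right)+\mathcal{O}(\eta^2).$$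
   Context: Leverage scores: if $A$ is a real $m\times n$ matrix with $\mathrm{rank}(A)=n$ and $Q$ is any $m\times n$ matrix whose columns form an orthonormal basis of $\mathrm{range}(A)$, the leverage scores of $A$ are $\ell_j=\|e_j^TQ\|_2^2$, $1\le j\le m$, where $e_j$ is the $j$th column of the $m\times m$ identity (this is independent of the choice of $Q$). The leverage scores computed from a thin QR decomposition $A+\Delta A=\tilde{Q}\tilde{R}$ ($\tilde{Q}$ being $m\times n$ with orthonormal columns, $\tilde{R}$ being $n\times n$ upper triangular and nonsingular) are $\tilde{\ell}_j=\|e_j^T\tilde{Q}\|_2^2$; exact arithmetic is assumed. $\|\cdot\|_2$ is the spectral norm, $A^\dagger$ the Moore-Penrose inverse, and $\kappa_2(A)=\|A\|_2\|A^\dagger\|_2$. The hypothesis $\eta\,\kappa_2(A)<1$ implies $\mathrm{rank}(A+\Delta A)=n$. The symbol $\mathcal{O}(\eta^2)$ is understood for fixed $A$ as $\eta\to0$: it is a term bounded by $C\eta^2$ for all admissible $\eta_j,\zeta_j$ with $\eta$ sufficiently small, where $C$ and the smallness threshold depend only on $A$. *)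

(* Defs.v *)
From HB Require Import structures.
From mathcomp Require Import all_boot all_order all_algebra.
From mathcomp Require Import all_classical all_reals all_analysis.

Set Implicit Arguments.
Unset Strict Implicit.
Unset Printing Implicit Defensive.

Import Order.TTheory GRing.Theory Num.Theory.

Local Open Scope classical_set_scope.
Local Open Scope ring_scope.

Section Norms.
Variable R : realType.

Definition norm2 (n : nat) (x : 'cV[R]_n) : R :=
  Num.sqrt (\sum_(i < n) x i 0 ^+ 2).

Definition spectral_norm (m n : nat) (A : 'M[R]_(m, n)) : R :=
  sup [set norm2 (A *m x) | x in [set x : 'cV[R]_n | norm2 x <= 1]].

(* The four Penrose conditions. *)
Definition is_moore_penrose (m n : nat) (A : 'M[R]_(m, n)) (X : 'M[R]_(n, m)) :
    Prop :=
  [/\ A *m X *m A = A, X *m A *m X = X,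
      (A *m X)^T = A *m X & (X *m A)^T = X *m A].

(* MathComp's [pinvmx] is a partial inverse that need not satisfy the two
   symmetry conditions, hence this definition. *)
Definition moore_penrose (m n : nat) (A : 'M[R]_(m, n)) : 'M[R]_(n, m) :=
  xget 0 [set X | is_moore_penrose A X].

Definition kappa2 (m n : nat) (A : 'M[R]_(m, n)) : R :=
  spectral_norm A * spectral_norm (moore_penrose A).

End Norms.

Section MoorePenrose.
Variables (R : realType) (m n : nat) (A : 'M[R]_(m, n)).

Lemma is_moore_penrose_uniq X Y :
  is_moore_penrose A X -> is_moore_penrose A Y -> X = Y.
Proof.
move=> [a1 a2 a3 a4] [b1 b2 b3 b4].
have e1 : A *m X = A *m Y.
  rewrite -[A *m X]a3 -{1}b1 -(mulmxA (A *m Y)) trmx_mul a3 b3.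
  by rewrite mulmxA a1.
have e2 : X *m A = Y *m A.
  by rewrite -[X *m A]a4 -{1}b1 -mulmxA mulmxA trmx_mul b4 a4 -mulmxA
     [A *m (X *m A)]mulmxA a1.
by rewrite -a2 -mulmxA e1 mulmxA e2 b2.
Qed.

Hypothesis rkA : \rank A = n.

Lemma gram_unitmx : A^T *m A \in unitmx.
Proof.
rewrite -row_free_unit -kermx_eq0; apply/eqP/row_matrixP => i.
rewrite row0; set u := row i _.
have u0 : u *m (A^T *m A) = 0 by apply/sub_kermxP; exact: row_sub.
have : (u *m A^T) *m (u *m A^T)^T = 0.
  by rewrite trmx_mul trmxK mulmxA -(mulmxA u) u0 mul0mx.
move def_v : (u *m A^T) => v vv0.
have v0 : v = 0.
  move/(congr1 (fun M : 'M[R]_1 => M 0 0)): vv0; rewrite mxE [RHS]mxE.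
  under eq_bigr do rewrite mxE -expr2.
  move/eqP; rewrite psumr_eq0; last by move=> k _; exact: sqr_ge0.
  move=> /allP h; apply/rowP => k; rewrite [RHS]mxE; apply/eqP.
  by have := h k (mem_index_enum k); rewrite /= expf_eq0.
have fr : row_free A^T by rewrite /row_free mxrank_tr rkA.
by apply: (row_free_inj fr); rewrite def_v v0 mul0mx.
Qed.

Lemma moore_penroseP : is_moore_penrose A (moore_penrose A).
Proof.
apply: (@xgetPex _ 0 [set X | is_moore_penrose A X]).
have G := gram_unitmx.
have E : invmx (A^T *m A) *m A^T *m A = 1%:M by rewrite -mulmxA mulVmx.
exists (invmx (A^T *m A) *m A^T); split.
- by rewrite -mulmxA E mulmx1.
- by rewrite E mul1mx.
- by rewrite !trmx_mul trmxK trmx_inv trmx_mul trmxK mulmxA.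
- by rewrite E trmx1.
Qed.

End MoorePenrose.

Section Leverage.
Variable R : realType.

(* MathComp's [==] on matrices in %MS compares row spaces, so the column space
   (range) is the row space of the transpose. *)
Definition orthonormal_range_basis (m n : nat) (A Q : 'M[R]_(m, n)) : Prop :=
  Q^T *m Q = 1%:M /\ (Q^T == A^T)%MS.

(* [is_trig_mx] means lower triangular. *)
Definition thin_QR (m n : nat) (B Q : 'M[R]_(m, n)) (T : 'M[R]_n) : Prop :=
  [/\ B = Q *m T, Q^T *m Q = 1%:M, is_trig_mx T^T & T \in unitmx].

(* Squared norm of the row e_j^T Q; it is the j-th leverage score of any A of
   which Q is an orthonormal range basis. *)
Definition leverage (m n : nat) (Q : 'M[R]_(m, n)) (j : 'I_m) : R :=
  norm2 (row j Q)^T ^+ 2.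

(* The base value 0 is harmless: this is only used for nonnegative families. *)
Definition max_coord (m : nat) (eta : 'I_m -> R) : R :=
  \big[Order.max/0]_(j < m) eta j.

End Leverage.

Section Uniform.
Variable R : realType.

Lemma ltN11 : -1 < 1 :> R.
Proof. exact: gtrN. Qed.

(* Values in [-1, 1] are required surely, not just almost surely, since the
   result is claimed for every realization. *)
Definition uniform_rv (d : measure_display) (T : measurableType d)
    (P : probability T R) (X : {RV P >-> R}) : Prop :=
  (forall w, -1 <= X w <= 1) /\
  (forall B : set R, measurable B -> distribution P X B = uniform_prob ltN11 B).

End Uniform.

(* Main.v *)
Require Import Defs.
From HB Require Import structures.
From mathcomp Require Import all_boot all_order all_algebra.
From mathcomp Require Import all_classical all_reals all_analysis.
From mathcomp Require Import ring lra.

Set Implicit Arguments.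
Unset Strict Implicit.
Unset Printing Implicit Defensive.

Import Order.TTheory GRing.Theory Num.Theory.

Local Open Scope classical_set_scope.
Local Open Scope ring_scope.

(** The perturbation is a row scaling: [A + dA = (I + D) A] with
    [D = diag (zeta_j eta_j)], [`|D| <= eta].  Writing [A = Q S] gives
    [Qt = (I + D) Q M] with [M = S Rt^-1], and since [Q] and [Qt] have
    orthonormal columns,
    [(1 - eta)^2 |M x|^2 <= |x|^2 <= (1 + eta)^2 |M x|^2] for all [x].
    The same bounds hold for [M^T], so that the [j]-th leverage score
    [(1 + d_j)^2 |M^T q_j|^2] of [A + dA] satisfies
    [(1 + d_j)^2 / (1 + eta)^2 <= lt_j / l_j <= (1 + d_j)^2 / (1 - eta)^2].
    To first order the relative error is thus at most [2 (eta_j + eta)],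
    and [1 <= sqrt 2 * n]. *)

Section SquaredNorm.
Variable R : realType.

(** Stated as a matrix product so that isometries and transposes are handled by associativity,
    without square roots. *)
Definition sqn (n : nat) (x : 'cV[R]_n) : R := (x^T *m x) 0 0.

Lemma sqnE n (x : 'cV[R]_n) : sqn x = \sum_i x i 0 ^+ 2.
Proof. by rewrite /sqn mxE; apply: eq_bigr => i _; rewrite mxE expr2. Qed.

Lemma sqn_ge0 n (x : 'cV[R]_n) : 0 <= sqn x.
Proof. by rewrite sqnE sumr_ge0// => i _; exact: sqr_ge0. Qed.

Lemma sqnZ n (c : R) (x : 'cV[R]_n) : sqn (c *: x) = c ^+ 2 * sqn x.
Proof.
by rewrite !sqnE mulr_sumr; apply: eq_bigr => i _; rewrite mxE exprMn.
Qed.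

Lemma sqnBZ n (t : R) (x y : 'cV[R]_n) :
  sqn (x - t *: y) = sqn x - 2 * t * (x^T *m y) 0 0 + t ^+ 2 * sqn y.
Proof.
rewrite !sqnE mxE !mulr_sumr -sumrN -!big_split/=.
by apply: eq_bigr => i _; rewrite !mxE; ring.
Qed.

Lemma sqn_isometry m n (Q : 'M[R]_(m, n)) (x : 'cV[R]_n) :
  Q^T *m Q = 1%:M -> sqn (Q *m x) = sqn x.
Proof.
by move=> QQ; rewrite /sqn trmx_mul mulmxA -(mulmxA x^T) QQ mulmx1.
Qed.

Lemma leverage_sqn m n (Q : 'M[R]_(m, n)) (j : 'I_m) :
  leverage Q j = sqn (row j Q)^T.
Proof. by rewrite /leverage /norm2 -sqnE sqr_sqrtr// sqn_ge0. Qed.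

(* A matrix and its transpose have the same operator norm: expand
   [0 <= |q - c M M^T q|^2]. *)
Lemma sqn_contraction_tr n (M : 'M[R]_n) (c : R) : 0 < c ->
    (forall x, c * sqn (M *m x) <= sqn x) ->
  forall q, c * sqn (M^T *m q) <= sqn q.
Proof.
move=> c0 h q; set y := M^T *m q.
have := sqn_ge0 (q - c *: (M *m y)); rewrite sqnBZ.
have -> : (q^T *m (M *m y)) 0 0 = sqn y.
  by rewrite /sqn trmx_mul trmxK mulmxA.
(* [h0] reads [0 <= |q|^2 - 2 c |y|^2 + c^2 |M y|^2], and [hy] bounds the last term by [c |y|^2]. *)
move=> h0; have := ler_wpM2l (ltW c0) (h y) => hy; nra.
Qed.

(** Since [0 <= 1 - e <= 1 + D i <= 1 + e], squaring preserves the order in each coordinate. *)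
Lemma sqn_diag_bounds m (D : 'I_m -> R) (e : R) (x y : 'cV[R]_m) :
    e <= 1 -> (forall i, `|D i| <= e) ->
    (forall i, y i 0 = (1 + D i) * x i 0) ->
  (1 - e) ^+ 2 * sqn x <= sqn y <= (1 + e) ^+ 2 * sqn x.
Proof.
move=> e1 hD hy; rewrite !sqnE !mulr_sumr.
by apply/andP; split; apply: ler_sum => i _; rewrite hy exprMn;
  have := hD i; rewrite ler_norml => /andP[? ?];
  rewrite ler_wpM2r ?sqr_ge0//; nra.
Qed.

Lemma leverage_row_scaling m n (A dA Q Qt : 'M[R]_(m, n)) (Rt : 'M[R]_n)
    (D : 'I_m -> R) (e : R) :
    e < 1 -> (forall i, `|D i| <= e) ->
    (forall i, row i dA = D i *: row i A) ->
    orthonormal_range_basis A Q -> thin_QR (A + dA) Qt Rt ->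
  forall j, (1 - e) ^+ 2 * leverage Qt j <= (1 + D j) ^+ 2 * leverage Q j
         /\ (1 + D j) ^+ 2 * leverage Q j <= (1 + e) ^+ 2 * leverage Qt j.
Proof.
move=> e1 hD hdA [QQ QA] [QR QtQt _ Ru] j.
have e0 : 0 <= e by apply: le_trans (hD j).
have [S AS] : exists S, A = Q *m S.
  move: QA => /andP[_ /submxP[S AS]]; exists S^T.
  by rewrite -[A]trmxK AS trmx_mul trmxK.
pose M := S *m invmx Rt.
have rowQt i : row i Qt = (1 + D i) *: (row i Q *m M).
  have -> : Qt = (A + dA) *m invmx Rt by rewrite QR mulmxK.
  rewrite row_mul linearD/= hdA -[X in X + _]scale1r -scalerDl.
  by rewrite -scalemxAl AS row_mul /M mulmxA.
have Qt_entry (x : 'cV[R]_n) i :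
    (Qt *m x) i 0 = (1 + D i) * (Q *m (M *m x)) i 0.
  have := congr1 (fun B : 'rV[R]_1 => B 0 0) (row_mul i Qt x).
  rewrite rowQt -scalemxAl -!mulmxA -row_mul.
  by rewrite [LHS]mxE [RHS]mxE [X in _ * X]mxE.
have M_bounds x : (1 - e) ^+ 2 * sqn (M *m x) <= sqn x
                  <= (1 + e) ^+ 2 * sqn (M *m x).
  have := sqn_diag_bounds (ltW e1) hD (Qt_entry x).
  by rewrite (sqn_isometry _ QQ) (sqn_isometry _ QtQt).
(* With [E = I + D], [Qt = E Q M] and [Qt^T Qt = 1], so [Qt^T E Q] is a left inverse of the square
   matrix [M]. *)
have Mu : M \in unitmx.
  pose E : 'M[R]_m := diag_mx (\row_i (1 + D i)).
  have QtE : Qt = E *m Q *m M.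
    apply/row_matrixP => i; rewrite rowQt -mulmxA row_mul row_diag_mx mxE.
    by rewrite -scalemxAl -rowE row_mul.
  have : (Qt^T *m (E *m Q)) *m M = 1%:M by rewrite -QtQt {3}QtE !mulmxA.
  by case/mulmx1_unit.
have trQt : (row j Qt)^T = (1 + D j) *: (M^T *m (row j Q)^T).
  by rewrite rowQt linearZ/= trmx_mul.
have e1_gt0 : 0 < 1 + e by lra.
rewrite !leverage_sqn trQt sqnZ; set q := (row j Q)^T.
have up : (1 - e) ^+ 2 * sqn (M^T *m q) <= sqn q.
  apply: sqn_contraction_tr; first by rewrite exprn_gt0// subr_gt0.
  by move=> x; have /andP[] := M_bounds x.
(* The transposition lemma is applied to [invmx M] at the vector [M^T q], which the transpose of
   [invmx M] sends back to [q]. *)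
have lo : sqn q <= (1 + e) ^+ 2 * sqn (M^T *m q).
  have c0 : 0 < ((1 + e) ^+ 2)^-1 by rewrite invr_gt0 exprn_gt0.
  have invM_bound x : ((1 + e) ^+ 2)^-1 * sqn (invmx M *m x) <= sqn x.
    rewrite ler_pdivrMl ?exprn_gt0//.
    by have /andP[_] := M_bounds (invmx M *m x); rewrite mulKVmx.
  have := sqn_contraction_tr c0 invM_bound (M^T *m q).
  rewrite mulmxA -trmx_mul mulmxV// trmx1 mul1mx.
  by rewrite ler_pdivrMl ?exprn_gt0.
split.
  by rewrite mulrCA ler_wpM2l// sqr_ge0.
by rewrite [leRHS]mulrCA ler_wpM2l// sqr_ge0.
Qed.

End SquaredNorm.

(** The upper bound fixes the constant: [(1 - e)^2 (r - 1) <= 2 (ej + e)], while replacing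
    [2 (ej + e)] by its product with [(1 - e)^2] loses at most [8 e^2]. As [(1 - e)^2 >= 1/4], the
    term [32 e^2] makes up for this loss. *)
Lemma ratio_first_order (R : realType) (e ej d r : R) :
    `|d| <= ej -> ej <= e -> e <= 1 / 2 ->
    (1 - e) ^+ 2 * r <= (1 + d) ^+ 2 -> (1 + d) ^+ 2 <= (1 + e) ^+ 2 * r ->
  `|r - 1| <= 2 * (ej + e) + 32 * e ^+ 2.
Proof.
rewrite ler_norml => /andP[d1 d2] eje e12 up lo.
have dup : (1 + d) ^+ 2 <= (1 + ej) ^+ 2 by nra.
have dlo : (1 - ej) ^+ 2 <= (1 + d) ^+ 2 by nra.
have ej0 : 0 <= ej by lra.
have e0 : 0 <= e by lra.
have e1_gt0 : 0 < (1 - e) ^+ 2 by rewrite exprn_gt0//; lra.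
have e2_gt0 : 0 < (1 + e) ^+ 2 by rewrite exprn_gt0//; lra.
have eje2 : ej * e <= e ^+ 2 by rewrite expr2 ler_wpM2r.
have ejej : ej ^+ 2 <= e ^+ 2 by rewrite ler_sqr ?nnegrE.
have e2_ge0 : 0 <= e ^+ 2 := sqr_ge0 e.
rewrite ler_norml; apply/andP; split.
  rewrite -(ler_pM2l e2_gt0) mulrBr mulr1 lerBrDr.
  apply: le_trans lo; apply: le_trans dlo; nra.
rewrite -(ler_pM2l e1_gt0) mulrBr mulr1 lerBlDr.
apply: le_trans up _; apply: le_trans dup _.
have q4 : 1 / 4 <= (1 - e) ^+ 2 by nra.
have := ler_wpM2r e2_ge0 q4 => ?.
have : e ^+ 2 * (ej + e) <= e ^+ 2 by rewrite ler_piMr//; lra.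
nra.
Qed.

Theorem theorem3p4 (R : realType) (m n : nat) (A : 'M[R]_(m, n)) :
  \rank A = n ->
  exists C eta0 : R, [/\ 0 <= C, 0 < eta0 &
    forall (d : measure_display) (T : measurableType d) (P : probability T R)
           (zeta : 'I_m -> {RV P >-> R}) (eta : 'I_m -> R),
      (forall j, uniform_rv (zeta j)) ->
      (forall j, 0 <= eta j) ->
      max_coord eta * kappa2 A < 1 ->
      max_coord eta < eta0 ->
    forall (w : T) (dA Q Qt : 'M[R]_(m, n)) (Rt : 'M[R]_n),
      (forall j, row j dA = (zeta j w * eta j) *: row j A) ->
      orthonormal_range_basis A Q ->
      thin_QR (A + dA) Qt Rt ->
    forall j, 0 < leverage Q j ->
      `|leverage Qt j - leverage Q j| / leverage Q j
        <= 2 * (eta j + Num.sqrt 2 * n%:R * max_coord eta)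
           + C * max_coord eta ^+ 2].
Proof.
(* Both constants come from [ratio_first_order]: its second-order coefficient and its range
   [e <= 1 / 2]. *)
move=> _; exists 32, (1 / 2); split; [by []|by []|].
move=> d T P zeta eta hz eta_ge0 _ eta_lt w dA Q Qt Rt hdA hQ hQt j lj_gt0.
have eta_le i : eta i <= max_coord eta by exact: le_bigmax.
have dle i : `|zeta i w * eta i| <= eta i.
  rewrite normrM (ger0_norm (eta_ge0 i)) ler_piMl// ler_norml.
  by have [] := hz i.
have eta_lt1 : max_coord eta < 1 by lra.
have [up lo] := leverage_row_scaling eta_lt1
  (fun i => le_trans (dle i) (eta_le i)) hdA hQ hQt j.
have -> : `|leverage Qt j - leverage Q j| / leverage Q j
          = `|leverage Qt j / leverage Q j - 1|.
  rewrite -{2}(gtr0_norm lj_gt0) -normf_div mulrBl divff//.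
  by rewrite gt_eqF.
apply: le_trans (ratio_first_order (dle j) (eta_le j) (ltW eta_lt) _ _) _.
- by rewrite mulrA ler_pdivrMr.
- by rewrite mulrA ler_pdivlMr.
have max_ge0 : 0 <= max_coord eta := le_trans (eta_ge0 j) (eta_le j).
(* For [n = 0] the rows of [Q] are empty, so the leverage score would be 0. *)
have n_ge1 : 1 <= n%:R :> R.
  rewrite ler1n lt0n; apply/eqP => n0; move: lj_gt0.
  rewrite leverage_sqn sqnE big1 ?ltxx// => i _.
  by exfalso; have := leq_ltn_trans (leq0n i) (ltn_ord i); rewrite n0.
have sqrt2_ge1 : 1 <= Num.sqrt 2 :> R.
  by rewrite -[leLHS]sqrtr1 ler_sqrt// ler1n.
have sn_ge1 : 1 <= Num.sqrt 2 * n%:R :> R by rewrite mulr_ege1.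
by rewrite lerD2r ler_pM2l// lerD2l ler_peMl.
Qed.
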